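(* Let $(R,+,\cdot,\sharp)$ be a left commutative rng. Then the nil radical of $R$ is the intersection of the Hu-Liu prime ideals of $R$: $$\mathrm{nilrad}^{\sharp}(R)=\bigcap_{P\in \mathrm{spec}^{\sharp}R}P .$$
   Context: A rng is an associative ring not assumed to have an identity; ''ring'' means a ring with identity. A left commutative rng $(R,+,\cdot,\sharp)$ is a rng $(R,+,\cdot)$ such that: (i) $xyz=yxz$ for all $x,y,z\in R$; (ii) there is a left identity $1^{\ell}\in R$, i.e. $1^{\ell}x=x$ for all $x\in R$; (iii) on the additive halo $\hbar^+(R):=\{x\in R : x1^{\ell}=0\}$ (which does not depend on the choice of left identity) there is given a binary operation $\sharp$, the local product, such that $(\hbar^+(R),+,\sharp)$ is a commutative ring with an identity $1^{\sharp}$, the local identity; (iv) $(x\alpha)\,\sharp\,\beta=x(\alpha\,\sharp\,\beta)$ for all $\alpha,\beta\in\hbar^+(R)$, $x\in R$. An ideal of $R$ is an additive subgroup $I$ with $RI\subseteq I$, $IR\subseteq I$ and $I\cap\hbar^+(R)$ an ideal of the ring $(\hbar^+(R),+,\sharp)$. A Hu-Liu prime ideal of $R$ is an ideal $P\neq R$ such that: (i) for $x,y\in R$, $xy\in P+\hbar^+(R)$ implies $x\in P+\hbar^+(R)$ or $y\in P+\hbar^+(R)$; (ii) for $x,y\in R$, $xy\in P$ implies $x\in P+\hbar^+(R)$ or $y\in P$; (iii) $P\supseteq\hbar^+(R)$, or $P\cap\hbar^+(R)$ is a prime ideal of the commutative ring $(\hbar^+(R),+,\sharp)$. The set of all Hu-Liu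 prime ideals of $R$ is denoted $\mathrm{spec}^{\sharp}R$ (an intersection over the empty family is $R$). Fix a left identity $1^{\ell}$. Every $x\in R$ decomposes as $x=x_0+x_1$ with $x_0=x1^{\ell}\in R1^{\ell}$ and $x_1=x-x1^{\ell}\in\hbar^+(R)$ (the odd component of $x$). For $\alpha\in\hbar^+(R)$ and $n\ge1$, $\alpha^{\sharp n}$ is the $n$-fold product of $\alpha$ with itself under $\sharp$. An element $x\in R$ is nilpotent if $x^m=0$ and $x_1^{\sharp n}=0$ for some positive integers $m,n$ (this does not depend on the choice of left identity). The nil radical $\mathrm{nilrad}^{\sharp}(R)$ is the set of nilpotent elements of $R$. *)

(* Defs.v *)
From HB Require Import structures.
From mathcomp Require Import all_boot all_algebra.
From mathcomp Require Import boolp classical_sets.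

Set Implicit Arguments.
Unset Strict Implicit.
Unset Printing Implicit Defensive.

Import GRing.Theory.
Local Open Scope ring_scope.

Reserved Notation "x *l y" (at level 40, left associativity).

(* MathComp has no rngs, so the non-unital product is introduced here.
   A left identity is part of the structure (the fixed 1^l); quantifying over
   the structure quantifies over all its choices.  See halo_lidE and
   nilpotent_lidE for the independence of that choice. *)
HB.mixin Record Zmodule_isLeftUnitalRng R & GRing.Zmodule R := {
  lmul : R -> R -> R;
  lid : R;
  lmulA : associative lmul;
  lmulDl : left_distributive lmul +%R;
  lmulDr : right_distributive lmul +%R;
  lmulLC : forall x y z, lmul (lmul x y) z = lmul (lmul y x) z;
  lmul1l : left_id lid lmul;
}.

#[short(type="leftUnitalRngType")]
HB.structure Definition LeftUnitalRng :=
  { R of Zmodule_isLeftUnitalRng R & GRing.Zmodule R }.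

Notation "x *l y" := (lmul x y) : ring_scope.

Section Halo.
Variable R : leftUnitalRngType.
Implicit Types x y e : R.

(* The additive halo of R. *)
Definition halo : {pred R} := [pred x : R | x *l lid == 0].

Lemma lmul0l x : 0 *l x = 0.
Proof. by apply: (addrI (0 *l x)); rewrite -lmulDl !addr0. Qed.

Lemma lmul0r x : x *l 0 = 0.
Proof. by apply: (addrI (x *l 0)); rewrite -lmulDr !addr0. Qed.

Lemma lmulNl x y : (- x) *l y = - (x *l y).
Proof. by apply: (addrI (x *l y)); rewrite -lmulDl !subrr lmul0l. Qed.

Lemma lmulBl x y z : (x - y) *l z = x *l z - y *l z.
Proof. by rewrite lmulDl lmulNl. Qed.

Lemma halo_lidE e : left_id e lmul -> forall x, (x \in halo) = (x *l e == 0).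
Proof.
move=> e1 x; rewrite inE; apply/eqP/eqP => x0.
  by rewrite -[e]lmul1l lmulA x0 lmul0l.
by rewrite -[lid]e1 lmulA x0 lmul0l.
Qed.

Fact halo_zmod_closed : zmod_closed halo.
Proof.
split=> [|x y]; rewrite !inE ?lmul0l // => /eqP x0 /eqP y0.
by rewrite lmulBl x0 y0 subrr.
Qed.
HB.instance Definition _ := GRing.isZmodClosed.Build R halo halo_zmod_closed.

Record haloType := Halo { halo_val :> R; halo_valP : halo_val \in halo }.
HB.instance Definition _ := [isSub for halo_val].
HB.instance Definition _ := [Choice of haloType by <:].
HB.instance Definition _ := [SubChoice_isSubZmodule of haloType by <:].

Fact lmul_halo_subproof x (a : haloType) : x *l halo_val a \in halo.
Proof.
by have := halo_valP a; rewrite !inE -lmulA => /eqP->; rewrite lmul0r.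
Qed.

(* The action x a of R on its halo by left multiplication. *)
Definition lmul_halo x (a : haloType) : haloType :=
  Halo (lmul_halo_subproof x a).

Fact odd_part_subproof x : x - x *l lid \in halo.
Proof. by rewrite inE lmulBl -lmulA lmul1l subrr. Qed.

Definition odd_part x : haloType := Halo (odd_part_subproof x).

End Halo.

HB.mixin Record LeftUnitalRng_isLeftCommRng R & LeftUnitalRng R := {
  sharp : haloType R -> haloType R -> haloType R;
  sharp1 : haloType R;
  sharpA : associative sharp;
  sharpC : commutative sharp;
  sharp1l : left_id sharp1 sharp;
  sharpDl : left_distributive sharp +%R;
  sharp_lmull : forall (x : R) (a b : haloType R),
    sharp (lmul_halo x a) b = lmul_halo x (sharp a b);
}.

#[short(type="leftCommRngType")]
HB.structure Definition LeftCommRng :=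
  { R of LeftUnitalRng_isLeftCommRng R & LeftUnitalRng R }.

(* The commutative ring (halo, +, sharp), possibly trivial.  This alias lets
   its product, unit and powers be the generic a * b, 1 and a ^+ n. *)
Definition sharp_ring (R : leftCommRngType) : Type := haloType R.

Section SharpRing.
Variable R : leftCommRngType.
HB.instance Definition _ := GRing.Zmodule.on (sharp_ring R).
HB.instance Definition _ := GRing.Zmodule_isComPzRing.Build (sharp_ring R)
  (@sharpA R) (@sharpC R) (@sharp1l R) (@sharpDl R).
End SharpRing.

Local Open Scope classical_set_scope.

(* MathComp's idealr_closed requires a nontrivial ring and a proper ideal,
   whereas the halo may be 0 and ideals may be improper. *)
Definition is_subgroup (V : zmodType) (I : set V) : Prop :=
  I 0 /\ forall x y, I x -> I y -> I (x - y).

Definition is_ring_ideal (A : comPzRingType) (I : set A) : Prop :=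
  is_subgroup I /\ forall a x, I x -> I (a * x).

Definition is_prime_ideal (A : comPzRingType) (I : set A) : Prop :=
  [/\ is_ring_ideal I, I <> setT &
      forall a b, I (a * b) -> I a \/ I b].

Section HuLiu.
Variable R : leftCommRngType.
Implicit Types (I P : set R) (x y : R).

Definition halo_set : set R := [set x | x \in @halo R].

(* I :&: halo, as a subset of the ring (halo, +, sharp). *)
Definition halo_trace I : set (sharp_ring R) :=
  [set a : sharp_ring R | I (halo_val a)].

Definition is_ideal I : Prop :=
  [/\ is_subgroup I,
      forall r x, I x -> I (r *l x),
      forall r x, I x -> I (x *l r) &
      is_ring_ideal (halo_trace I)].

Definition add_halo P : set R := [set p + a | p in P & a in halo_set].

Definition is_HuLiu_prime P : Prop :=
  [/\ is_ideal P /\ P <> setT,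
      forall x y, add_halo P (x *l y) -> add_halo P x \/ add_halo P y,
      forall x y, P (x *l y) -> add_halo P x \/ P y &
      halo_set `<=` P \/ is_prime_ideal (halo_trace P)].

Definition sharp_spec : set (set R) := [set P | is_HuLiu_prime P].

(* x^n = x ( ... (x x)) with n factors, meaningful for n > 0 only, as R need
   not have an identity. *)
Definition lexp x (n : nat) : R := iterop n (@lmul R) x 0.

Definition nilpotent x : Prop :=
  (exists2 m : nat, (0 < m)%N & lexp x m = 0) /\
  (exists2 n : nat, (0 < n)%N & (odd_part x : sharp_ring R) ^+ n = 0).

Definition sharp_nilrad : set R := [set x | nilpotent x].

End HuLiu.

Arguments sharp_spec : clear implicits.
Arguments sharp_nilrad : clear implicits.

Section NilpotentIndependence.
Variable R : leftCommRngType.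
Implicit Types (x e : R) (a b d : sharp_ring R).

Lemma lexpS x n : lexp x n.+2 = x *l lexp x n.+1.
Proof. by []. Qed.

Lemma lmul_halo_exp x d n :
  (lmul_halo x d : sharp_ring R) ^+ n.+1 = lmul_halo (lexp x n.+1) (d ^+ n.+1).
Proof.
elim: n => [//|n IHn]; rewrite exprS {}IHn.
transitivity (sharp (lmul_halo x d) (lmul_halo (lexp x n.+1) (d ^+ n.+1))) => //.
rewrite sharp_lmull sharpC sharp_lmull; apply: val_inj => /=.
by rewrite lmulA -lexpS sharpC.
Qed.

Lemma sharp_nilpotentD a b n m :
  a ^+ n = 0 -> b ^+ m = 0 -> (a + b) ^+ (n + m) = 0.
Proof.
move=> an0 bm0; rewrite exprDn big1 // => i _.
have [mi|im] := leqP m i.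
  by rewrite -(subnK mi) [b ^+ _]exprD bm0 !mulr0 mul0rn.
have ni : (n <= n + m - i)%N by rewrite -addnBA ?leq_addr // ltnW.
by rewrite -(subnK ni) exprD an0 mulr0 mul0r mul0rn.
Qed.

Lemma nilpotent_lidE e x a :
    left_id e (@lmul R) -> halo_val a = x - x *l e ->
  nilpotent x <->
    (exists2 m : nat, (0 < m)%N & lexp x m = 0) /\
    (exists2 n : nat, (0 < n)%N & a ^+ n = 0).
Proof.
move=> e1 aE.
have dP : lid - e \in @halo R by rewrite inE lmulBl lmul1l e1 subrr.
pose c : sharp_ring R := lmul_halo x (Halo dP).
have aoc : a = (odd_part x : sharp_ring R) + c.
  apply: val_inj; rewrite /= aE; apply/eqP.
  rewrite -subr_eq0 -[x *l (lid - e)]addr0 lmulDr.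
  have -> : x *l (- e) = - (x *l e).
    by apply: (addrI (x *l e)); rewrite -lmulDr !subrr lmul0r.
  by rewrite addr0 addrA subrK subrr.
split=> -[[m m0 xm0] [n n0 an0]]; (split; first by exists m);
    exists (n + m)%N; rewrite ?addn_gt0 ?n0 //.
all: have cm0 : c ^+ m = 0 by
  case: m m0 xm0 => // m _ xm0; rewrite lmul_halo_exp xm0;
  apply: val_inj; rewrite /= lmul0l.
  by rewrite aoc; apply: sharp_nilpotentD.
have -> : (odd_part x : sharp_ring R) = a + (- c) by rewrite aoc addrK.
by apply: sharp_nilpotentD; rewrite // exprNn cm0 mulr0.
Qed.

End NilpotentIndependence.

(* Main.v *)
Require Import Defs.
From HB Require Import structures.
From mathcomp Require Import all_boot all_algebra.
From mathcomp Require Import boolp classical_sets.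
Local Open Scope classical_set_scope.

Set Implicit Arguments.
Unset Strict Implicit.
Unset Printing Implicit Defensive.

Import GRing.Theory.
Local Open Scope ring_scope.

(** Everything reduces to Krull's theorem that a non-nilpotent element of a
commutative ring avoids some prime ideal, applied to two commutative rings
attached to [R].

Write [e] for the left identity and [H] for the additive halo.  Since
[a y = a (e y) = (a e) y], an element [a] of [H] kills everything on its right,
so [R = R e + H] is a split extension: [R e] is a commutative ring with
identity [e], the halo is a commutative ring under the local product, and the
whole multiplication is
  [x y = x_0 y_0 + f(x) # y_1],
where [x_0 = x e], [x_1 = x - x e] and [f(x) = x 1#] is a ring homomorphism to
[H] that vanishes on [H].  In other words [H] is an algebra over [R e].

Nilpotency splits accordingly: [x ^ m] has even part [x_0 ^ m], and
[x ^ (m+1) = x ^ m x] only depends on [x_0 ^ m] and [x], so [x] is nilpotent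
exactly when [x_0] and [x_1] are nilpotent in their respective rings
([nilpotentE]).

The split description also makes the Hu-Liu primes visible.  A prime [p] of
[R e] gives [{x | x_0 in p}] ([even_prime]), which contains [H]; a prime [q] of
[H] gives [{x | f(x) in q and x_1 in q}] ([odd_prime]), whose trace on [H] is
[q].  If [x_0] is not nilpotent, Krull's theorem yields a prime of the first
kind missing [x]; if [x_1] is not nilpotent, it yields one of the second kind.
Conversely a Hu-Liu prime contains both parts of any nilpotent element
([nilpotent_HuLiu_prime]). *)

(** * Prime ideals avoiding a non-nilpotent element *)
Section Krull.
Variable A : comPzRingType.
Implicit Types (I : set A) (a b c : A).

(** Ideals disjoint from the powers of [a], without the condition that they
contain 0: the empty set is then allowed, so that the union of an empty chain
needs no separate treatment. *)
Let stable_avoiding a : set (set A) := [set I |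
  [/\ forall x y, I x -> I y -> I (x - y), forall r x, I x -> I (r * x) &
      forall n, ~ I (a ^+ n)]].

(** A maximal ideal [M] among those that contain no power of [a] is prime: if
[b] and [c] lie outside [M], then [M + (b)] and [M + (c)] both contain a power
of [a], and the product of the two powers would lie in [M] if [b * c] did. *)
Lemma exists_prime_avoiding a :
  (forall n, a ^+ n <> 0) -> exists2 P, is_prime_ideal P & ~ P a.
Proof.
move=> a_nn.
have [F FS Ftot|M [[MB MM Ma] Mmax]] := Zorn_bigcup (P := stable_avoiding a).
  split=> [x y [I FI Ix] [J FJ Jy]|r x [I FI Ix]|n [I FI]].
  - have [IJ|JI] := Ftot I J FI FJ.
      by exists J => //; have [JB _ _] := FS J FJ; apply/JB => //; apply: IJ.
    by exists I => //; have [IB _ _] := FS I FI; apply/IB => //; apply: JI.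
  - by exists I => //; have [_ IM _] := FS I FI; apply: IM.
  - by have [_ _ Ia] := FS I FI; apply: Ia.
(* If [M] were empty, then [{0}] would be a strictly larger candidate. *)
have M0 : M 0.
  have [[x Mx]|noM] := pselect (exists x, M x).
    by rewrite -(subrr x); apply: MB.
  case: (Mmax [set 0]).
    split=> [x Mx|sub]; first by case: noM; exists x.
    by case: noM; exists 0; apply: sub.
  split=> [x y -> ->|r x ->|n /a_nn//]; first by rewrite /= subr0.
  by rewrite /= mulr0.
have power_mod b : ~ M b -> exists n m r, M m /\ a ^+ n = m + r * b.
  move=> Mb; apply: contrapT => no_power.
  case: (Mmax [set x | exists m r, M m /\ x = m + r * b]).
    split=> [x Mx|sub]; first by exists x, 0; rewrite mul0r addr0.
    by apply/Mb/sub; exists 0, 1; rewrite mul1r add0r.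
  split=> [_ _ [m [r [Mm ->]]] [m' [r' [Mm' ->]]]|s _ [m [r [Mm ->]]]|n].
  - exists (m - m'), (r - r'); split; first exact: MB.
    by rewrite mulrBl opprD addrACA.
  - exists (s * m), (s * r); split; first exact: MM.
    by rewrite mulrDr mulrA.
  - by move=> [m [r mr]]; apply: no_power; exists n, m, r.
exists M; last exact: (Ma 1).
split=> [||b c Mbc]; first by [].
  by move=> MT; apply: (Ma 0); rewrite MT.
apply: contrapT => /not_orP[Mb Mc].
have [n [m [r [Mm En]]]] := power_mod b Mb.
have [k [p [s [Mp Ek]]]] := power_mod c Mc.
have MD x y : M x -> M y -> M (x + y).
  by move=> Mx My; rewrite -[y]opprK; apply/MB => //; rewrite -sub0r; apply/MB.
apply: (Ma (n + k)); rewrite exprD En Ek mulrDl; apply: (MD).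
  by rewrite mulrC; apply: MM.
rewrite mulrDr; apply: (MD); first exact: MM.
by rewrite mulrACA; apply: MM.
Qed.

End Krull.

(** * The commutative ring of even elements *)
Section EvenRing.
Variable R : leftUnitalRngType.
Implicit Types x y : R.

(** The even elements are those of [R e]: they are the fixed points of right
multiplication by [e]. *)
Definition even : {pred R} := [pred x : R | x *l lid == x].

Fact even_zmod_closed : zmod_closed even.
Proof.
split=> [|x y]; rewrite !inE ?lmul0l // => /eqP xe /eqP ye.
by rewrite lmulBl xe ye.
Qed.
HB.instance Definition _ := GRing.isZmodClosed.Build R even even_zmod_closed.

Record evenType := Even { even_val :> R; even_valP : even_val \in even }.
HB.instance Definition _ := [isSub for even_val].
HB.instance Definition _ := [Choice of evenType by <:].
HB.instance Definition _ := [SubChoice_isSubZmodule of evenType by <:].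

Lemma evenE (u : evenType) : even_val u *l lid = even_val u.
Proof. exact/eqP/even_valP. Qed.

Fact even_part_subproof x : x *l lid \in even.
Proof. by rewrite inE -lmulA lmul1l. Qed.

Definition even_part x : evenType := Even (even_part_subproof x).

(** The product of even elements is already even; the projection only supplies
the membership proof. *)
Definition even_mul (u v : evenType) : evenType := even_part (u *l v).

Fact even_mulA : associative even_mul.
Proof. by move=> u v w; apply: val_inj; rewrite /= -!lmulA !lmul1l. Qed.

Fact even_mulC : commutative even_mul.
Proof. by move=> u v; apply: val_inj; rewrite /= lmulLC. Qed.

Fact even_mul1l : left_id (even_part lid) even_mul.
Proof. by move=> u; apply: val_inj; rewrite /= !lmul1l evenE. Qed.

Fact even_mulDl : left_distributive even_mul +%R.
Proof. by move=> u v w; apply: val_inj; rewrite /= !lmulDl. Qed.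

HB.instance Definition _ := GRing.Zmodule_isComPzRing.Build evenType
  even_mulA even_mulC even_mul1l even_mulDl.

Lemma even_part_is_zmod_morphism : zmod_morphism even_part.
Proof. by move=> x y; apply: val_inj; rewrite /= lmulBl. Qed.
HB.instance Definition _ :=
  GRing.isZmodMorphism.Build R evenType even_part even_part_is_zmod_morphism.

Lemma even_partM x y : even_part (x *l y) = even_part x * even_part y.
Proof. by apply: val_inj; rewrite /= -!lmulA !lmul1l. Qed.

End EvenRing.

(** * The decomposition into even and odd parts *)
Section Parts.
Variable R : leftCommRngType.
Implicit Types (x y : R) (a : sharp_ring R).

(** The reason for the whole structure: [a y = a (e y) = (a e) y = 0]. *)
Lemma halo_lmul a y : halo_val a *l y = 0.
Proof. by rewrite -[y]lmul1l lmulA (eqP (halo_valP a)) lmul0l. Qed.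

Lemma even_part_halo a : even_part (halo_val a) = 0.
Proof. by apply: val_inj; rewrite /= halo_lmul. Qed.

Lemma even_part_lid : even_part (@lid R) = 1.
Proof. by []. Qed.

Lemma parts_sumE x : x = even_val (even_part x) + halo_val (odd_part x).
Proof. by rewrite /= addrC subrK. Qed.

Lemma odd_partB x y :
  (odd_part (x - y) : sharp_ring R) = odd_part x - odd_part y.
Proof. by apply: val_inj; rewrite /= lmulBl !opprD addrACA. Qed.

Lemma odd_part_halo a : odd_part (halo_val a) = a.
Proof. by apply: val_inj; rewrite /= halo_lmul subr0. Qed.

Lemma odd_part_lid : (odd_part (@lid R) : sharp_ring R) = 0.
Proof. by apply: val_inj; rewrite /= lmul1l subrr. Qed.

(** The homomorphism through which [R] acts on its halo, making the halo an
algebra. *)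
Definition structure_map x : sharp_ring R := lmul_halo x (sharp1 : haloType R).

(** Compatibility of the two products turns the action [x a] into the local
product of [a] with the element [x 1#] of the halo. *)
Lemma lmul_haloE x a : lmul_halo x a = structure_map x * a :> sharp_ring R.
Proof.
rewrite -[structure_map x * a]/(sharp (structure_map x) a) sharp_lmull.
by rewrite sharp1l.
Qed.

Lemma structure_mapB x y :
  structure_map (x - y) = structure_map x - structure_map y.
Proof. by apply: val_inj; rewrite /= lmulBl. Qed.

Lemma structure_mapM x y :
  structure_map (x *l y) = structure_map x * structure_map y.
Proof. by rewrite -lmul_haloE; apply: val_inj; rewrite /= lmulA. Qed.

Lemma structure_map_lid : structure_map lid = 1.
Proof. by apply: val_inj; rewrite /= lmul1l. Qed.

Lemma structure_map_halo a : structure_map (halo_val a) = 0.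
Proof. by apply: val_inj; rewrite /= halo_lmul. Qed.

(** Only the odd part of the right factor survives, because that of the left
factor kills [y]. *)
Lemma odd_partM x y :
  (odd_part (x *l y) : sharp_ring R) = structure_map x * odd_part y.
Proof.
rewrite -lmul_haloE; apply: val_inj => /=.
rewrite lmulDr -lmulA; congr (_ + _); apply: (addrI (x *l (y *l lid))).
by rewrite -lmulDr !subrr lmul0r.
Qed.

Lemma even_part_lexp x n : even_part (lexp x n.+1) = even_part x ^+ n.+1.
Proof. by elim: n => [//|n IHn]; rewrite lexpS even_partM IHn -exprS. Qed.

(** The extra factor is what removes the odd part: [x ^ (n+2)] is
[x ^ (n+1) x = (x ^ (n+1) e) x], which only sees the even part of
[x ^ (n+1)]. *)
Lemma lexp_even x n :
  even_part x ^+ n.+1 = 0 -> lexp x n.+2 = 0.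
Proof.
rewrite -even_part_lexp => /(congr1 (@even_val R)) xn0.
have -> : lexp x n.+2 = lexp x n.+1 *l x.
  by elim: n {xn0} => [//|n IHn]; rewrite (lexpS x n.+1) {1}IHn lmulA.
by rewrite -[x in _ *l x]lmul1l lmulA [_ *l lid]xn0 lmul0l.
Qed.

Lemma nilpotentE x : nilpotent x <->
  (exists n, even_part x ^+ n = 0) /\
  (exists n, (odd_part x : sharp_ring R) ^+ n = 0).
Proof.
split=> [[[[//|m] _ xm0] [n _ xn0]]|[[m xm0] [n xn0]]].
  split; last by exists n.
  by exists m.+1; rewrite -even_part_lexp xm0; apply: val_inj; rewrite /= lmul0l.
split; [exists m.+2 | exists n.+1] => //; last by rewrite exprS xn0 mulr0.
by apply: lexp_even; rewrite exprS xm0 mulr0.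
Qed.

End Parts.

(** * Hu-Liu primes and nilpotent elements *)
Section Primes.
Variable R : leftCommRngType.
Implicit Types (x y : R) (a : sharp_ring R) (P : set R).
Implicit Types (p : set (evenType R)) (q : set (sharp_ring R)).

Lemma prime_ideal_exp (A : comPzRingType) (I : set A) (a : A) n :
  is_prime_ideal I -> I (a ^+ n) -> I a.
Proof.
move=> [[_ IM] _ Ipr]; elim: n => [I1|n IHn].
  by rewrite -[a]mulr1; apply: IM.
by rewrite exprS => /Ipr[].
Qed.

(** Membership in [P + H] is a condition on the even part alone, because right
multiplication by [e] kills [H]. *)
Lemma add_haloE P x :
  (forall r x, P x -> P (x *l r)) -> add_halo P x <-> P (x *l lid).
Proof.
move=> Pr; split=> [[p Pp [a /= /eqP a0 <-]]|Px].
  by rewrite lmulDl a0 addr0; apply: Pr.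
exists (x *l lid) => //; exists (halo_val (odd_part x)); first exact: halo_valP.
by rewrite /= addrC subrK.
Qed.

(** The even part lies in [P] because [P + H] has the prime property and contains
[x ^ m = 0].  The odd part lies in [P] because the trace of [P] on the halo is
either everything or a prime ideal. *)
Lemma nilpotent_HuLiu_prime x P : nilpotent x -> is_HuLiu_prime P -> P x.
Proof.
move=> [[[//|m] _ xm0] [n _ xn0]].
move=> [[[[P0 PB] _ Pr [[_ _] _]] _] Ppr _ Podd].
have even_x : P (even_val (even_part x)).
  apply/(add_haloE x Pr); have : add_halo P (lexp x m.+1).
    by rewrite xm0; exists 0 => //; exists 0; rewrite ?addr0 //; apply: rpred0.
  by elim: m {xm0} => [//|m IHm]; rewrite lexpS => /Ppr[].
have odd_x : P (halo_val (odd_part x)).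
  case: Podd => [|Podd]; first by apply; apply: halo_valP.
  apply: (prime_ideal_exp (n := n) Podd).
  by rewrite xn0.
rewrite [x]parts_sumE -[halo_val _]opprK; apply: (PB) => //.
by rewrite -[- _]sub0r; apply: PB.
Qed.

Definition even_prime p : set R := [set x | p (even_part x)].

(** The even part is a surjective homomorphism onto the ring of even elements, so
the prime property of [p] pulls back; the preimage contains the halo, so adding
the halo to it changes nothing. *)
Lemma even_prime_HuLiu p : is_prime_ideal p -> is_HuLiu_prime (even_prime p).
Proof.
move=> [[[p0 pB] pM] pT ppr].
have Pr r x : even_prime p x -> even_prime p (x *l r).
  by rewrite /even_prime /= even_partM mulrC; apply: pM.
have add_even x : add_halo (even_prime p) x <-> even_prime p x.
  by rewrite add_haloE // /even_prime /= even_partM even_part_lid mulr1.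
have halo_even : @halo_set R `<=` even_prime p.
  by move=> x hx; rewrite /even_prime /= (even_part_halo (Halo hx)).
split; last by left.
- split.
    split=> //.
    + split=> [|x y]; rewrite /even_prime /= ?raddf0 // raddfB; exact: pB.
    + by move=> r x; rewrite /even_prime /= even_partM; apply: pM.
    + by split; [split=> *|move=> *]; apply/halo_even/halo_valP.
  move=> PT; apply: pT; apply/seteqP; split=> // u _.
  have <- : even_part (even_val u) = u by apply: val_inj; rewrite /= evenE.
  by have : [set: R] (even_val u) by []; rewrite -PT.
- move=> x y /add_even; rewrite /even_prime /= even_partM => /ppr[] ?.
    by left; apply/add_even.
  by right; apply/add_even.
- move=> x y; rewrite /even_prime /= even_partM => /ppr[] ?; last by right.
  by left; apply/add_even.
Qed.

(** The condition on [structure_map x] is forced by the requirement that [x a] lie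
in the ideal for every [a] in the halo: for [a = 1#] it says exactly this. *)
Definition odd_prime q : set R :=
  [set x | q (structure_map x) /\ q (odd_part x)].

(** Adding the halo drops the condition on the odd part, so membership of [x] in the
sum means [structure_map x] in [q].  With that, each axiom is primality of [q]
applied to a product [structure_map x * _]. *)
Lemma odd_prime_HuLiu q : is_prime_ideal q -> is_HuLiu_prime (odd_prime q).
Proof.
move=> q_prime; have [[[q0 qB] qM] qT qpr] := q_prime.
have Pr r x : odd_prime q x -> odd_prime q (x *l r).
  move=> [qx _]; rewrite /odd_prime /= structure_mapM odd_partM.
  by split; rewrite mulrC; apply: qM.
have add_odd x : add_halo (odd_prime q) x <-> q (structure_map x).
  rewrite add_haloE // /odd_prime /= structure_mapM odd_partM.
  by rewrite structure_map_lid odd_part_lid mulr1 mulr0; split=> [[]|].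
have traceE : halo_trace (odd_prime q) = q.
  apply/seteqP; split=> a; rewrite /odd_prime /halo_trace /=.
    by rewrite odd_part_halo => -[].
  by rewrite structure_map_halo odd_part_halo.
split; last by right; rewrite traceE.
- split.
    split=> //.
    + split=> [|x y [qx qx1] [qy qy1]]; rewrite /odd_prime /=.
        by rewrite -(subrr 0) structure_mapB odd_partB !subrr.
      by rewrite structure_mapB odd_partB; split; apply: qB.
    + move=> r x [qx qx1]; rewrite /odd_prime /= structure_mapM odd_partM.
      by split; apply: qM.
    + by rewrite traceE.
  by move=> PT; apply: qT; rewrite -traceE PT.
- move=> x y /add_odd; rewrite structure_mapM => /qpr[] ?.
    by left; apply/add_odd.
  by right; apply/add_odd.
- move=> x y; rewrite /odd_prime /= structure_mapM odd_partM.
  move=> [/qpr qxy /qpr qxy1].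
  case: qxy => [?|qy]; first by left; apply/add_odd.
  case: qxy1 => [?|qy1]; first by left; apply/add_odd.
  by right.
Qed.

End Primes.

Theorem proposition2p3 (R : leftCommRngType) :
  sharp_nilrad R = \bigcap_(P in sharp_spec R) P.
Proof.
apply/seteqP; split=> x.
  by move=> x_nil P P_prime; apply: nilpotent_HuLiu_prime.
move=> x_primes; apply/nilpotentE; split; apply: contrapT => not_nil.
  have [n xn|p p_prime] := @exists_prime_avoiding _ (even_part x).
    by apply: not_nil; exists n.
  by apply; apply: (x_primes _ (even_prime_HuLiu p_prime)).
have [n xn|q q_prime] :=
    @exists_prime_avoiding _ (odd_part x : sharp_ring R).
  by apply: not_nil; exists n.
by apply; have [] := x_primes _ (odd_prime_HuLiu q_prime).
Qed.
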